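(* There is a universal constant $C$ such that the following holds. Let $N\ge 1$ and let $\xi_1<\dots<\xi_N$ be arbitrary real numbers. Let $f\in L^1(\mathbb{R})$ and let $\lambda>0$. Then there is a decomposition $$f=g+\sum_{I\in \mathbf{I}} b_I$$ for some collection $\mathbf{I}$ of pairwise disjoint intervals with $$\sum_{I\in \mathbf{I}} |I|\le C N^{1/2} \|f\|_{L^1}\lambda^{-1},$$ such that $$\|g\|_{L^2}^2\le C \|f\|_{L^1} N^{1/2} \lambda ,$$ and such that for each $I\in \mathbf{I}$ and each $1\le j\le N$: $$\|f_I\|_{L^1}\le C|I|\lambda,\qquad \|f_I - b_I\|_{L^2} \le C|I|^{1/2} \lambda N^{1/2},\qquad \int_{\mathbb{R}} b_I(x) e^{i\xi_j x}\, dx=0,$$ where $f_I=f\cdot 1_I$ is the product of $f$ with the characteristic function of $I$, and the support of $b_I$ is contained in $3I$.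
   Context: For an interval $I$, $|I|$ denotes its length and $3I$ denotes the interval with the same center as $I$ and three times its length. *)

(* Defs.v *)
(* Complex-valued functions R -> C are represented
   as functions R -> R * R (real part, imaginary part). *)
From HB Require Import structures.
From mathcomp Require Import all_boot all_order all_algebra.
From mathcomp Require Import all_classical all_reals all_analysis.
Set Implicit Arguments. Unset Strict Implicit. Unset Printing Implicit Defensive.
Import Order.TTheory GRing.Theory Num.Theory.
Local Open Scope classical_set_scope.
Local Open Scope ring_scope.

Section Defs.
Variable R : realType.

Definition cmod (z : R * R) : R := Num.sqrt (z.1 ^+ 2 + z.2 ^+ 2).

Definition cmeasurable (h : R -> R * R) : Prop :=
  measurable_fun setT (fun x => (h x).1) /\ measurable_fun setT (fun x => (h x).2).

Definition L1norm (h : R -> R * R) : \bar R :=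
  (\int[@lebesgue_measure R]_x (cmod (h x))%:E)%E.

Definition L2norm2 (h : R -> R * R) : \bar R :=
  (\int[@lebesgue_measure R]_x ((cmod (h x)) ^+ 2)%:E)%E.

Definition restr (I : set R) (h : R -> R * R) : R -> R * R :=
  fun x => if `[< I x >] then h x else (0, 0).

Definition csub (h k : R -> R * R) : R -> R * R :=
  fun x => ((h x).1 - (k x).1, (h x).2 - (k x).2).

(* 3I for I = ]a, c[ : same center, three times the length *)
Definition triple (a c : R) : set R := `](a - (c - a)), (c + (c - a))[.

(* Re and Im of  \int h(x) e^{i xi x} dx *)
Definition fourier_re (h : R -> R * R) (xi : R) : \bar R :=
  (\int[@lebesgue_measure R]_x ((h x).1 * cos (xi * x) - (h x).2 * sin (xi * x))%:E)%E.
Definition fourier_im (h : R -> R * R) (xi : R) : \bar R :=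
  (\int[@lebesgue_measure R]_x ((h x).1 * sin (xi * x) + (h x).2 * cos (xi * x))%:E)%E.

Definition cintegrable (h : R -> R * R) : Prop :=
  (@lebesgue_measure R).-integrable setT (fun x => ((h x).1)%:E) /\
  (@lebesgue_measure R).-integrable setT (fun x => ((h x).2)%:E).

End Defs.

(* Main.v *)
(** The intervals are the Whitney intervals of [O = {M f > t}], where [M] is the
    Hardy-Littlewood maximal function and [t = lam / sqrt N].  On such an
    interval [I] the [L1] norm of [f] is at most a constant times [|I| t], since
    a point outside [O] lies within a multiple of [|I|].

    The projection step needs the bound
    [|g y|^2 <= (C N / |I|) * \int_(3I) |g|^2] for [y] in [I] and [g] in the
    span of the [N] frequencies.  The integral over [I] of the Christoffel
    function of the span is at most its dimension, so some [x0] in [I] satisfies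
    [|g x0|^2 <= (C N / |I|) * \int_I |g|^2] for all [g]; the span is
    translation invariant, and translating by [y - x0] keeps [I] inside [3I].
    By duality there is [w] in the span, cut off to [3I], with the same Fourier
    coefficients as [f 1_I] at the given frequencies and
    [\int |w|^2 <= (C N / |I|) (\int_I |f|)^2]; take [b_I = f 1_I - w].

    Whitney intervals split into 12 classes within each of which the triples
    [3I] are pairwise disjoint, which controls the [L2] norm of the sum of the
    [w]. *)
Require Import Defs.
From HB Require Import structures.
From mathcomp Require Import all_boot all_order all_algebra.
From mathcomp Require Import all_classical all_reals all_analysis.
From mathcomp Require Import measurable_realfun zify ring lra.
Import Order.TTheory GRing.Theory Num.Theory.
Import numFieldNormedType.Exports.
Set Implicit Arguments. Unset Strict Implicit. Unset Printing Implicit Defensive.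
Local Open Scope classical_set_scope.
Local Open Scope ring_scope.

(** * Generalized inverses of symmetric matrices *)

Lemma mxtrace_pid (F : numFieldType) m (r : nat) : (r <= m)%N ->
  \tr (pid_mx r : 'M[F]_m) = r%:R.
Proof.
move=> rm; transitivity (\sum_(i < m) if (i < r)%N then 1 else 0 : F).
  by apply: eq_bigr => i _; rewrite mxE eqxx /=; case: ifP.
by rewrite -big_mkcond /= (big_ord_narrow rm) sumr_const card_ord.
Qed.

(** Writing [G] through [col_ebase], [pid_mx] and [row_ebase] shows that [pinvmx G *m G] is
    conjugate to [pid_mx] of the rank, so its trace is the rank. *)
Lemma ginv_trace (F : numFieldType) m (G : 'M[F]_m) :
  G *m pinvmx G *m G = G /\ \tr (pinvmx G *m G) <= m%:R.
Proof.
split; first exact: mulmxKpV.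
rewrite /pinvmx -{4}[G]mulmx_ebase -!mulmxA mxtrace_mulC -!mulmxA.
rewrite (mulmxA (invmx _) (col_ebase _)) mulVmx ?col_ebase_unit// mul1mx.
rewrite mulmxV ?row_ebase_unit// mulmx1 pid_mx_id ?rank_leq_row//.
by rewrite mxtrace_pid ?rank_leq_row// ler_nat rank_leq_row.
Qed.

(** For any generalized inverse [X] of a symmetric [G], the transpose of [X] is one too, and
    [X *m G *m X^T] is symmetric and reflexive. Its product with [G] collapses to [X *m G], so the
    trace bound carries over. *)
Lemma symmetric_reflexive_ginv (F : numFieldType) m (G : 'M[F]_m) : G^T = G ->
  exists S : 'M[F]_m, [/\ S^T = S, S *m G *m S = S, G *m S *m G = G &
    \tr (S *m G) <= m%:R].
Proof.
move=> sG; have [] := ginv_trace G; move: (pinvmx G) => X GXG trX.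
have GXtG : G *m X^T *m G = G.
  by have := congr1 trmx GXG; rewrite !trmx_mul sG mulmxA.
exists (X *m G *m X^T); split.
- by rewrite !trmx_mul trmxK sG mulmxA.
- rewrite !mulmxA -(mulmxA X G X^T) -(mulmxA X (G *m X^T) G) GXtG.
  by rewrite -(mulmxA X G X) -(mulmxA X (G *m X) G) GXG mulmxA.
- by rewrite 2!(mulmxA G) GXG GXtG.
- by rewrite -!mulmxA [G *m (X^T *m G)]mulmxA GXtG.
Qed.

Lemma psd_Cauchy_Schwarz (F : realFieldType) m (G : 'M[F]_m) (a b : 'rV[F]_m) :
  G^T = G -> (forall u : 'rV[F]_m, 0 <= (u *m G *m u^T) 0 0) ->
  (a *m G *m b^T) 0 0 ^+ 2 <= (a *m G *m a^T) 0 0 * (b *m G *m b^T) 0 0.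
Proof.
move=> sG psd.
set A := (a *m G *m a^T) 0 0; set B := (b *m G *m b^T) 0 0.
set X := (a *m G *m b^T) 0 0.
have Xs : (b *m G *m a^T) 0 0 = X.
  have -> : b *m G *m a^T = (a *m G *m b^T)^T by rewrite !trmx_mul trmxK sG mulmxA.
  by rewrite mxE.
(* The form is nonnegative along the line [a + t *: b]; the claim is the discriminant condition for
   this quadratic in [t]. *)
have Q t : 0 <= A + t * X *+ 2 + t ^+ 2 * B.
  have := psd (a + t *: b).
  rewrite linearD /= linearZ /= !mulmxDl !mulmxDr -!scalemxAl -!scalemxAr.
  have mxD (P Q : 'M[F]_1) : (P + Q) 0 0 = P 0 0 + Q 0 0 by rewrite mxE.
  have mxZ c (P : 'M[F]_1) : (c *: P) 0 0 = c * P 0 0 by rewrite mxE.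
  rewrite !(mxD, mxZ) Xs -/A -/X -/B => /le_trans; apply.
  by rewrite le_eqVlt; apply/orP; left; apply/eqP; ring.
have A0 : 0 <= A by exact: psd.
have [B0|B0] := eqVneq B 0.
  rewrite B0 mulr0; have [->|X0] := eqVneq X 0; first by rewrite expr0n.
  (* In the degenerate case the quadratic is affine with nonzero slope; this [t] gives it the value
     -1. *)
  exfalso; have := Q (- (A + 1) / (X *+ 2)); rewrite B0 mulr0 addr0.
  have -> : A + - (A + 1) / (X *+ 2) * X *+ 2 = -1 by field.
  by rewrite lerNr oppr0 ler10.
have Bp : 0 < B by rewrite lt_neqAle eq_sym B0 psd.
have := Q (- X / B).
have -> : A + - X / B * X *+ 2 + (- X / B) ^+ 2 * B = (A * B - X ^+ 2) / B by field.
by rewrite pmulr_lge0 ?invr_gt0// subr_ge0.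
Qed.

(** * Christoffel function and projection on a finite-dimensional span *)

Section gram.
Context (d : measure_display) (T : measurableType d) (R : realType).
Context (mu : {measure set T -> \bar R}).
Implicit Types (D : set T) (F : T -> R).

Definition rintegrable D F := mu.-integrable D (EFin \o F).

Lemma rintegrableZ D F (c : R) : measurable D -> rintegrable D F ->
  rintegrable D (fun x => c * F x).
Proof. by move=> mD iF; exact: (integrableZl mD c iF). Qed.

Lemma rintegrableD D F F' : measurable D -> rintegrable D F -> rintegrable D F' ->
  rintegrable D (fun x => F x + F' x).
Proof. by move=> mD iF iF'; exact: (integrableD mD iF iF'). Qed.

Lemma rintegrableB D F F' : measurable D -> rintegrable D F -> rintegrable D F' ->
  rintegrable D (fun x => F x - F' x).
Proof. by move=> mD iF iF'; exact: (integrableB mD iF iF'). Qed.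

Lemma rintegrable_sum (I : finType) D (F : I -> T -> R) : measurable D ->
  (forall i, rintegrable D (F i)) -> rintegrable D (fun x => \sum_i F i x).
Proof.
move=> mD iF; rewrite /rintegrable.
have -> : EFin \o (fun x => \sum_i F i x) = (fun x => \sum_i (F i x)%:E)%E.
  by apply/funext => x /=; rewrite sumEFin.
by apply: integrable_sum => // i _; exact: iF.
Qed.

Lemma Rintegral_sum (I : finType) D (F : I -> T -> R) : measurable D ->
  (forall i, rintegrable D (F i)) ->
  \int[mu]_(x in D) (\sum_i F i x) = \sum_i \int[mu]_(x in D) F i x.
Proof.
move=> mD iF; rewrite /Rintegral.
under eq_integral do rewrite -sumEFin.
rewrite integral_sum//.
rewrite -sum_fine// => i _.
by apply: integrable_fin_num => //; exact: iF.
Qed.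

Lemma Rintegral_sqr_eq0 D F : measurable D -> rintegrable D (fun x => F x ^+ 2) ->
  \int[mu]_(x in D) F x ^+ 2 = 0 -> {ae mu, forall x, D x -> F x = 0}.
Proof.
move=> mD iF F0.
have mF := measurable_int mu iF.
have : (\int[mu]_(x in D) `|(F x ^+ 2)%:E|)%E = 0%E.
  transitivity (\int[mu]_(x in D) (F x ^+ 2)%:E)%E.
    by apply: eq_integral => x _ /=; rewrite ger0_norm// sqr_ge0.
  rewrite -(fineK (integrable_fin_num mD iF)).
  by move: F0; rewrite /Rintegral => ->.
move/(ae_eq_integral_abs mu mD mF); apply: filterS => x /= + Dx.
by move=> /(_ Dx) [] /eqP; rewrite sqrf_eq0 => /eqP.
Qed.

Context (m : nat) (v : 'I_m -> T -> R).
Implicit Types a b : 'rV[R]_m.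

Definition comb a (x : T) : R := \sum_i a 0 i * v i x.

Lemma combB a b x : comb (a - b) x = comb a x - comb b x.
Proof.
by rewrite /comb -sumrB; apply: eq_bigr => i _; rewrite !mxE mulrBl.
Qed.

Lemma comb_delta j x : comb (delta_mx 0 j) x = v j x.
Proof.
rewrite /comb (bigD1 j)//= mxE !eqxx mul1r big1 ?addr0// => i ij.
by rewrite mxE (negbTE ij) andbF mul0r.
Qed.

Definition gram D : 'M[R]_m := \matrix_(i, j) \int[mu]_(x in D) (v i x * v j x).

Lemma gram_sym D : (gram D)^T = gram D.
Proof.
apply/matrixP => i j; rewrite !mxE.
by apply: eq_Rintegral => x _; rewrite mulrC.
Qed.

Variable D : set T.
Hypothesis mD : measurable D.
Hypothesis iv : forall i j, rintegrable D (fun x => v i x * v j x).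

Let combM a b x : comb a x * comb b x =
  \sum_(p : 'I_m * 'I_m) (a 0 p.1 * b 0 p.2) * (v p.1 x * v p.2 x).
Proof.
rewrite /comb mulr_suml; under eq_bigr do rewrite mulr_sumr.
by rewrite pair_bigA /=; apply: eq_bigr => p _; ring.
Qed.

Lemma integrable_combM a b : rintegrable D (fun x => comb a x * comb b x).
Proof.
under [X in rintegrable _ X]funext do rewrite combM.
by apply: rintegrable_sum => // p; exact: rintegrableZ.
Qed.

Lemma integrable_comb_sqr a : rintegrable D (fun x => comb a x ^+ 2).
Proof. exact: integrable_combM. Qed.

Lemma gramE a b :
  (a *m gram D *m b^T) 0 0 = \int[mu]_(x in D) (comb a x * comb b x).
Proof.
under eq_Rintegral do rewrite combM.
rewrite Rintegral_sum//; last by move=> p; exact: rintegrableZ.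
rewrite mxE; under eq_bigr do rewrite mxE mulr_suml.
rewrite exchange_big pair_bigA /=; apply: eq_bigr => p _.
by rewrite RintegralZl//; [rewrite !mxE; ring|exact: iv].
Qed.

Lemma gram_psd a : 0 <= (a *m gram D *m a^T) 0 0.
Proof. by rewrite gramE Rintegral_ge0// => x _; rewrite -expr2 sqr_ge0. Qed.

(* The Gram matrix may be singular, since the [v i] need not be independent;
   [G S] still acts as the identity up to null functions. *)
Lemma comb_ginv (S : 'M[R]_m) b : gram D *m S *m gram D = gram D ->
  {ae mu, forall x, D x -> comb (b *m gram D *m S) x = comb b x}.
Proof.
move=> GSG.
have : \int[mu]_(x in D) comb (b - b *m gram D *m S) x ^+ 2 = 0.
  transitivity (((b - b *m gram D *m S) *m gram D *m (b - b *m gram D *m S)^T) 0 0).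
    by rewrite gramE.
  rewrite mulmxBl -!mulmxA (mulmxA (gram D)) GSG subrr mul0mx.
  by rewrite mxE.
move/(Rintegral_sqr_eq0 mD (integrable_comb_sqr _)); apply: filterS => x + Dx.
by move=> /(_ Dx); rewrite combB => /eqP; rewrite subr_eq0 => /eqP.
Qed.

Lemma exists_small_Christoffel (l : R) : (0 < m)%N -> 0 < l -> mu D = l%:E ->
  exists2 x0, D x0 & forall b,
    comb b x0 ^+ 2 <= (2 * m%:R / l) * \int[mu]_(x in D) comb b x ^+ 2.
Proof.
move=> m0 l0 muD.
(* [q] is the Christoffel function of the span, with integral [\tr (S *m G)]. *)
have [S [St SGS GSG trS]] := symmetric_reflexive_ginv (gram_sym D).
pose V x : 'rV[R]_m := \row_i v i x.
pose q x := (V x *m S *m (V x)^T) 0 0.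
have combE b x : comb b x = (b *m (V x)^T) 0 0.
  by rewrite mxE; apply: eq_bigr => i _; rewrite !mxE.
have qE x : q x = \sum_(p : 'I_m * 'I_m) S p.2 p.1 * (v p.1 x * v p.2 x).
  rewrite /q mxE; under eq_bigr do rewrite mxE mulr_suml.
  rewrite pair_bigA /=; apply: eq_bigr => p _.
  by rewrite !mxE; ring.
have iq : rintegrable D q.
  under [X in rintegrable _ X]funext do rewrite qE.
  by apply: rintegrable_sum => // p; exact: rintegrableZ.
have intq : \int[mu]_(x in D) q x <= m%:R.
  apply: le_trans trS; under eq_Rintegral do rewrite qE.
  rewrite Rintegral_sum//; last by move=> p; exact: rintegrableZ.
  rewrite /mxtrace; under [leRHS]eq_bigr do rewrite mxE.
  rewrite exchange_big pair_bigA /= le_eqVlt; apply/orP; left; apply/eqP.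
  by apply: eq_bigr => p _; rewrite RintegralZl//; [rewrite !mxE|exact: iv].
have q_ge0 x : 0 <= q x.
  have := gram_psd (V x *m S); rewrite trmx_mul St !mulmxA.
  by rewrite -(mulmxA (V x) S) -(mulmxA (V x)) SGS.
(* Read at a point [x], this says that [G S] fixes the column of values [v j x]: the reproducing
   property of the Christoffel kernel, valid almost everywhere. *)
have repr : {ae mu, forall x, forall j, D x ->
    comb (delta_mx 0 j *m gram D *m S) x = comb (delta_mx 0 j) x}.
  by apply: filter_forall => j; exact: comb_ginv.
have [x0 [Dx0 qx0 rx0]] : exists x, [/\ D x, q x <= 2 * m%:R / l &
    forall j, comb (delta_mx 0 j *m gram D *m S) x = comb (delta_mx 0 j) x].
  (* Otherwise [q] exceeds [2 * m%:R / l] almost everywhere on [D], and its integral is at least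
     [2 m], against the bound [m]. The factor 2 lets a non-strict integral inequality suffice. *)
  apply: contrapT => /forallNP nex.
  have mrl : 0 < m%:R :> R by rewrite ltr0n.
  have : (\int[mu]_(x in D) (2 * m%:R / l)%:E <= \int[mu]_(x in D) (q x)%:E)%E.
    apply: ae_ge0_le_integral => //.
    - by move=> x _; rewrite lee_fin divr_ge0 ?mulr_ge0// ltW.
    - by move=> x _; rewrite lee_fin q_ge0.
    - exact: (measurable_int mu iq).
    - apply: filterS repr => x rx Dx; rewrite lee_fin leNgt; apply/negP => qx.
      by apply: (nex x); split=> [//||j]; [exact: ltW|exact: rx].
  rewrite integral_cst// muD -(fineK (integrable_fin_num mD iq)) -EFinM lee_fin.
  rewrite divfK ?gt_eqF// => /le_trans /(_ intq).
  by rewrite leNgt ltr_pMl// ltr1n.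
exists x0 => // b.
(* Evaluation at [x0] becomes the Gram product with [V x0 *m S], whose Gram square is [q x0] because
   [S G S = S]. *)
have -> : comb b x0 = (b *m gram D *m (V x0 *m S)^T) 0 0.
  rewrite combE trmx_mul St -!mulmxA; congr ((b *m _) 0 0).
  apply/colP => j; have := rx0 j; rewrite !combE -!mulmxA -!rowE.
  by rewrite !mxE => /esym.
apply: le_trans (psd_Cauchy_Schwarz _ _ (gram_sym D) gram_psd) _.
rewrite gramE mulrC ler_wpM2r//.
  by rewrite Rintegral_ge0// => x _; rewrite -expr2 sqr_ge0.
apply: le_trans qx0; rewrite le_eqVlt; apply/orP; left; apply/eqP.
by rewrite trmx_mul St !mulmxA -(mulmxA (V x0) S) -(mulmxA (V x0)) SGS.
Qed.

(** The solution [comb b] represents integration against [F] on [I] as a Gram product. Testing it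
    against itself gives [X <= N * sqrt (K X)] for its squared norm [X] and the L1 norm [N] of [F];
    squaring and cancelling one [X] gives the bound. *)
Lemma local_projection (I : set T) (F : T -> R) (K : R) :
  measurable I -> I `<=` D -> rintegrable I F ->
  (forall j, rintegrable I (fun x => F x * v j x)) -> 0 <= K ->
  (forall b x, I x -> comb b x ^+ 2 <= K * \int[mu]_(x in D) comb b x ^+ 2) ->
  exists b,
    (forall j, \int[mu]_(x in D) (comb b x * v j x) = \int[mu]_(x in I) (F x * v j x))
    /\ \int[mu]_(x in D) comb b x ^+ 2 <= K * (\int[mu]_(x in I) `|F x|) ^+ 2.
Proof.
move=> mI ID iF iFv K0 supK.
have [S [St SGS GSG _]] := symmetric_reflexive_ginv (gram_sym D).
pose c : 'rV[R]_m := \row_j \int[mu]_(x in I) (F x * v j x).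
have Fcomb b : rintegrable I (fun x => F x * comb b x) /\
    \int[mu]_(x in I) (F x * comb b x) = (b *m c^T) 0 0.
  have E x : F x * comb b x = \sum_i b 0 i * (F x * v i x).
    by rewrite /comb mulr_sumr; apply: eq_bigr => i _; rewrite mulrCA.
  split.
    under [X in rintegrable _ X]funext do rewrite E.
    by apply: rintegrable_sum => // i; exact: rintegrableZ.
  under eq_Rintegral do rewrite E.
  rewrite Rintegral_sum//; last by move=> i; exact: rintegrableZ.
  rewrite mxE; apply: eq_bigr => i _.
  by rewrite RintegralZl//; [rewrite !mxE|exact: iFv].
(* Solvability with a possibly singular Gram matrix: combinations equal almost everywhere on [D] are
   equal almost everywhere on [I], so they have the same integral against [F]. *)
have cSG : c *m S *m gram D = c.
  apply/rowP => j.
  transitivity (((delta_mx 0 j : 'rV[R]_m) *m gram D *m S *m c^T) 0 0).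
    have -> : c *m S *m gram D = (gram D *m (S *m c^T))^T.
      by rewrite !trmx_mul St gram_sym trmxK.
    by rewrite -!mulmxA -rowE !mxE.
  rewrite -(Fcomb _).2 [RHS]mxE.
  have iFj : rintegrable I (fun x => F x * v j x) := iFv j.
  rewrite /Rintegral; congr fine; apply: ae_eq_integral => //.
  - exact: (measurable_int mu (Fcomb _).1).
  - exact: (measurable_int mu iFj).
  - apply: filterS (comb_ginv (delta_mx 0 j) GSG) => x + Ix.
    by move=> /(_ (ID _ Ix)) ->; rewrite comb_delta.
exists (c *m S).
have E j : \int[mu]_(x in D) (comb (c *m S) x * v j x) = c 0 j.
  under eq_Rintegral do rewrite -(comb_delta j).
  by rewrite -gramE cSG trmx_delta -colE mxE.
split=> [j|]; first by rewrite E mxE.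
set b := c *m S; set X := \int[mu]_(x in D) comb b x ^+ 2.
set N := \int[mu]_(x in I) `|F x|.
have X0 : 0 <= X by apply: Rintegral_ge0 => x _; exact: sqr_ge0.
have N0 : 0 <= N by apply: Rintegral_ge0.
have XE : X = \int[mu]_(x in I) (F x * comb b x).
  rewrite (Fcomb b).2 /X.
  under eq_Rintegral do rewrite expr2.
  by rewrite -gramE /b cSG trmx_mul St mulmxA.
have XN : X <= N * Num.sqrt (K * X).
  rewrite XE; apply: le_trans (ler_norm _) _.
  have iN : rintegrable I (fun x => `|F x|) by exact: integrable_norm.
  apply: (le_trans (le_normr_Rintegral mI (Fcomb b).1)).
  rewrite -RintegralZr//; apply: le_Rintegral => //.
  - exact: (integrable_norm (Fcomb b).1).
  - exact: (integrableZr mI _ iN).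
  - move=> x Ix; rewrite normrM ler_wpM2l// -sqrtr_sqr ler_wsqrtr//.
    by rewrite -XE; exact: supK.
have [->|Xn0] := eqVneq X 0; first by rewrite mulr_ge0// sqr_ge0.
have Xp : 0 < X by rewrite lt_neqAle eq_sym Xn0.
rewrite -(ler_pM2l Xp) -expr2.
have := lerXn2r 2 _ _ XN; rewrite !nnegrE => /(_ X0) /(_ _)/le_trans.
apply; first by rewrite mulr_ge0// sqrtr_ge0.
by rewrite exprMn sqr_sqrtr ?mulr_ge0// le_eqVlt; apply/orP; left; apply/eqP; ring.
Qed.

End gram.

(** * Trigonometric spans *)

Section trig.
Context (R : realType).
Notation mu := (@lebesgue_measure R).
Implicit Types (a b s : R) (F : R -> R).

Lemma continuous_rintegrable F a b : continuous F -> rintegrable mu `]a, b[ F.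
Proof.
move=> cF; apply: (@integrableS _ _ _ mu `[a, b]) => //.
  exact: subset_itv_oo_cc.
apply: continuous_compact_integrable; first exact: segment_compact.
exact: continuous_subspaceT.
Qed.

Lemma Rintegral_translation F a b s : a <= b -> continuous F ->
  \int[mu]_(x in `]a, b[) F (x + s) = \int[mu]_(x in `](a + s), (b + s)[) F x.
Proof.
move=> ab cF.
have cFs : continuous (fun x => F (x + s)).
  move=> x; apply: continuous_comp; last exact: cF.
  by apply: continuousD; [exact: cvg_id|exact: cvg_cst].
(* Substitution is applied on closed segments; the endpoints are null. *)
have cc G p q : continuous G -> \int[mu]_(x in `]p, q[) G x = \int[mu]_(x in `[p, q]) G x.
  move=> cG; have iG : mu.-integrable `[p, q] (EFin \o G).
    apply: continuous_compact_integrable; first exact: segment_compact.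
    exact: continuous_subspaceT.
  rewrite Rintegral_itv_obnd_cbnd ?Rintegral_itv_bndo_bndc//.
    by apply: integrableS iG => //; exact: subset_itv_co_cc.
  by apply: integrableS iG => //; exact: subset_itv_oo_cc.
rewrite !cc//.
have D1 : derive1 (fun x : R => x + s) = cst 1.
  by apply/funext => x; rewrite derive1E derive_val addr0.
rewrite /Rintegral (@integration_by_substitution_increasing R (fun x => x + s))//.
- by congr fine; apply: eq_integral => x _ /=; rewrite D1 /= mulr1.
- by move=> x y _ _; rewrite ltrD2r.
- by rewrite D1 => x _; exact: cvg_cst.
- by rewrite D1; exact: is_cvg_cst.
- by rewrite D1; exact: is_cvg_cst.
- split.
  + by move=> x _; apply: derivableD.
  + by apply: cvg_at_right_filter; apply: continuousD; [exact: cvg_id|exact: cvg_cst].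
  + by apply: cvg_at_left_filter; apply: continuousD; [exact: cvg_id|exact: cvg_cst].
- exact: continuous_subspaceT.
Qed.

Context (N : nat) (xi : 'I_N -> R).

(** Using [N] cosines and [N] sines in place of complex exponentials keeps the linear algebra real.
    Real and imaginary parts of [f] are then projected separately on the same span. *)
Definition trig (i : 'I_(N + N)) (x : R) : R :=
  match fintype.split i with inl j => cos (xi j * x) | inr j => sin (xi j * x) end.

Lemma trig_cos j x : trig (lshift N j) x = cos (xi j * x).
Proof.
rewrite /trig; case: split_ordP => [k /lshift_inj ->//|k /eqP].
by rewrite eq_lrshift.
Qed.

Lemma trig_sin j x : trig (rshift N j) x = sin (xi j * x).
Proof.
rewrite /trig; case: split_ordP => [k /esym/eqP|k /rshift_inj ->//].
by rewrite eq_lrshift.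
Qed.

Lemma continuous_trig i : continuous (trig i).
Proof.
rewrite /trig => x; case: (fintype.split i) => j.
  apply: (continuous_comp _ (@continuous_cos _ _)); exact: mulrl_continuous.
apply: (continuous_comp _ (@continuous_sin _ _)); exact: mulrl_continuous.
Qed.

Lemma trig_bound i x : `|trig i x| <= 1.
Proof.
rewrite /trig; case: (fintype.split i) => j; rewrite ler_norml.
  by rewrite cos_geN1 cos_le1.
by rewrite sin_geN1 sin_le1.
Qed.

Lemma continuous_comb (b : 'rV[R]_(N + N)) : continuous (comb trig b).
Proof.
rewrite /comb; apply: continuous_big; first exact: add_continuous.
by move=> i _ x; apply: continuousM; [exact: cvg_cst|exact: continuous_trig].
Qed.

(** By the addition formulas, a translation by [s] rotates the cosine and sine coefficients of
    frequency [xi j] by the angle [xi j * s]. *)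
Lemma comb_trig_shift s (b : 'rV[R]_(N + N)) :
  exists b' : 'rV[R]_(N + N), forall x, comb trig b (x + s) = comb trig b' x.
Proof.
exists (\row_i match fintype.split i with
  | inl j => b 0 (lshift N j) * cos (xi j * s) + b 0 (rshift N j) * sin (xi j * s)
  | inr j => b 0 (rshift N j) * cos (xi j * s) - b 0 (lshift N j) * sin (xi j * s)
  end) => x.
rewrite /comb !big_split_ord /= -!big_split /=; apply: eq_bigr => j _.
rewrite !trig_cos !trig_sin !mxE.
case: split_ordP => [k /lshift_inj <-|k /eqP]; last by rewrite eq_lrshift.
case: split_ordP => [k' /eqP|k' /rshift_inj <-]; first by rewrite eq_rlshift.
by rewrite mulrDr cosD sinD; ring.
Qed.

Lemma trig_comb_sup a c (b : 'rV[R]_(N + N)) x : (0 < N)%N -> a < c ->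
  `]a, c[%classic x ->
  comb trig b x ^+ 2 <=
    4 * N%:R / (c - a) * \int[mu]_(y in triple a c) comb trig b y ^+ 2.
Proof.
move=> N0 ac xac.
have iv i j : rintegrable mu `]a, c[ (fun x => trig i x * trig j x).
  by apply: continuous_rintegrable => y; apply: continuousM; exact: continuous_trig.
have muI : mu `]a, c[%classic = (c - a)%:E.
  by rewrite lebesgue_measure_itv/= lte_fin ac.
have mI : measurable (`]a, c[%classic : set (measurableTypeR R)) by [].
have [||x0 + small] := exists_small_Christoffel mI iv _ _ muI.
  by rewrite addn_gt0 N0.
  by rewrite subr_gt0.
rewrite /= in_itv/= => /andP[ax0 x0c].
move: xac; rewrite /= in_itv/= => /andP[ax xc].
(* Translating by [x - x0] moves the good point to [x]; since [x] and [x0] are less than [c - a]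
   apart, the translated interval stays in the triple. *)
have [b' b'E] := comb_trig_shift (x - x0) b.
have -> : comb trig b x = comb trig b' x0 by rewrite -b'E subrKC.
apply: le_trans (small b') _.
have -> : 2 * (N + N)%:R / (c - a) = 4 * N%:R / (c - a) :> R by rewrite natrD; ring.
rewrite ler_wpM2l//; first by rewrite divr_ge0 ?mulr_ge0// subr_ge0 ltW.
have cb2 : continuous (fun y => comb trig b y ^+ 2).
  by move=> y; apply: continuousM; exact: continuous_comb.
have -> : \int[mu]_(y in `]a, c[) comb trig b' y ^+ 2 =
    \int[mu]_(y in `]a, c[) comb trig b (y + (x - x0)) ^+ 2.
  by apply: eq_Rintegral => y _; rewrite b'E.
rewrite (Rintegral_translation _ (ltW ac) cb2).
rewrite /Rintegral fine_le//.
- exact: (integrable_fin_num _ (continuous_rintegrable _ _ cb2)).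
- exact: (integrable_fin_num _ (continuous_rintegrable _ _ cb2)).
- apply: ge0_subset_integral => //.
  + exact: measurable_itv.
  + exact: (measurable_int mu (continuous_rintegrable _ _ cb2)).
  + by move=> y _; rewrite lee_fin sqr_ge0.
  + by apply: subset_itv; rewrite bnd_simp; lra.
Qed.

Lemma trig_projection a c F : (0 < N)%N -> a < c -> rintegrable mu `]a, c[ F ->
  exists b : 'rV[R]_(N + N),
    (forall i, \int[mu]_(x in triple a c) (comb trig b x * trig i x) =
               \int[mu]_(x in `]a, c[) (F x * trig i x)) /\
    \int[mu]_(x in triple a c) comb trig b x ^+ 2 <=
      4 * N%:R / (c - a) * (\int[mu]_(x in `]a, c[) `|F x|) ^+ 2.
Proof.
move=> N0 ac iF.
rewrite /triple.
apply: (@local_projection _ (measurableTypeR R) R mu _ trig) => //.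
- by move=> i j; apply: continuous_rintegrable => y; apply: continuousM; exact: continuous_trig.
- by apply: subset_itv; rewrite bnd_simp; lra.
- move=> j; apply: (integrableMl _ iF) => //.
    by apply: measurable_funTS; apply: continuous_measurable_fun; exact: continuous_trig.
  by exists 1; split=> // M M1 y _; apply: le_trans (trig_bound _ _) (ltW M1).
- by rewrite divr_ge0 ?mulr_ge0// subr_ge0 ltW.
- by move=> b x; exact: trig_comb_sup.
Qed.

End trig.

(** * Whitney decomposition *)

Section whitney.
Context (R : realType).
Notation mu := (@lebesgue_measure R).
Variables (s : R) (O : set R).
Hypothesis s0 : 0 < s.
Implicit Types (m k : nat) (j : int) (x z : R).

Definition scale m : R := s / 2 ^+ m.

Lemma scale_gt0 m : 0 < scale m.
Proof. by rewrite divr_gt0// exprn_gt0. Qed.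

Lemma scaleD m k : scale m = 2 ^+ k * scale (m + k).
Proof.
by rewrite /scale exprD; field; rewrite !expf_neq0.
Qed.

(** Dyadic intervals are taken open, so neighbours are disjoint and only countably many grid points
    are missed. *)
Definition cell m j : set R := [set x | j%:~R * scale m < x < (j%:~R + 1) * scale m].

Definition fat_cell m j : set R :=
  [set x | (j%:~R - 2) * scale m < x < (j%:~R + 3) * scale m].

(** Levels are natural numbers, so cells have length at most [s]. Level 0 has no parent and is
    excluded later by choosing [s] larger than the measure of [O]. *)
Definition maximal_cell m j := fat_cell m j `<=` O /\
  forall m' j', (m' < m)%N -> cell m' j' `&` cell m j !=set0 -> ~ (fat_cell m' j' `<=` O).

Lemma cell_nested m m' j j' : (m <= m')%N -> cell m j `&` cell m' j' !=set0 ->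
  cell m' j' `<=` cell m j.
Proof.
move=> mm' [x []]; rewrite /cell/=.
have := scaleD m (m' - m); rewrite subnKC//.
have := scale_gt0 m'; move: (scale m) (scale m') => H h h0 -> {H}.
rewrite !mulrA => /andP[x1 x2] /andP[x3 x4] y /= /andP[y1 y2].
have E : 2 ^+ (m' - m) = (2 ^ (m' - m)%N)%:Z%:~R :> R by rewrite -natrX.
(* The common point gives strict inequalities between integers shifted by one, which sharpen to
   comparisons of the endpoints. *)
have le1 : j * (2 ^ (m' - m)%N)%:Z <= j'.
  rewrite -ltzD1 -(ltr_int R) intrM intrD -E -(ltr_pM2r h0); lra.
have le2 : j' + 1 <= (j + 1) * (2 ^ (m' - m)%N)%:Z.
  rewrite lezD1 -(ltr_int R) intrM intrD -E -(ltr_pM2r h0); lra.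
move: le1 le2; rewrite -!(ler_int R) !intrM !intrD -!E => le1 le2.
apply/andP; split.
  by apply: le_lt_trans y1; rewrite ler_pM2r.
by apply: lt_le_trans y2 _; rewrite ler_pM2r.
Qed.

Lemma cell_disjoint m j j' : j <> j' -> cell m j `&` cell m j' = set0.
Proof.
move=> jj'; rewrite -subset0 => x []; rewrite /cell/=.
have := scale_gt0 m; move: (scale m) => h h0 /andP[x1 x2] /andP[x3 x4].
have lt1 : j < j' + 1 by rewrite -(ltr_int R) intrD -(ltr_pM2r h0); lra.
have lt2 : j' < j + 1 by rewrite -(ltr_int R) intrD -(ltr_pM2r h0); lra.
by apply: jj'; lia.
Qed.

Lemma maximal_cell_disjoint m j m' j' : maximal_cell m j -> maximal_cell m' j' ->
  (m, j) <> (m', j') -> cell m j `&` cell m' j' = set0.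
Proof.
wlog : m m' j j' / (m <= m')%N => [wl|].
  case: (leqP m m') => [|/ltnW] mm' M M' ne; first exact: wl.
  by rewrite setIC; apply: wl => // E; apply: ne; rewrite E.
rewrite leq_eqVlt => /orP[/eqP <-|mm'] [P M] [P' M'] ne.
  by apply: cell_disjoint => E; apply: ne; rewrite E.
apply: contrapT => /eqP/set0P ne0.
exact: M' mm' ne0 P.
Qed.

(** With [j'] the integer half of [j], the number [2 j'] is [j] or [j - 1]. In units of the child,
    the parent's fat cell runs from [2 j' - 4] to [2 j' + 6]. *)
Lemma parent m j : exists j', cell m j' `&` cell m.+1 j !=set0 /\
  (forall x, fat_cell m j' x ->
    (j%:~R - 5) * scale m.+1 < x < (j%:~R + 6) * scale m.+1).
Proof.
rewrite /cell /fat_cell /=.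
have := scaleD m 1; rewrite addn1 expr1.
have := scale_gt0 m.+1; move: (scale m) (scale m.+1) => H h h0 -> {H}.
have [j' [j1 j2]] : exists j', 2 * j' <= j /\ j <= 2 * j' + 1.
  by exists (j %/ 2)%Z; lia.
move: j1 j2; rewrite -!(ler_int R) !intrD !intrM => j1 j2.
exists j'; split.
  exists ((j%:~R + 2^-1) * h); split=> /=; rewrite ?mulrA !ltr_pM2r//; lra.
move=> x /andP[]; rewrite !mulrA => x1 x2.
apply/andP; split.
  by apply: le_lt_trans x1; rewrite ler_pM2r//; lra.
by apply: lt_le_trans x2 _; rewrite ler_pM2r//; lra.
Qed.

Lemma maximal_cell_near_compl m j : maximal_cell m.+1 j ->
  exists z, ~ O z /\ (j%:~R - 5) * scale m.+1 < z < (j%:~R + 6) * scale m.+1.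
Proof.
move=> [_ M]; have [j' [ne0 sub]] := parent m j.
have /existsNP[z /not_implyP[Fz Oz]] := M _ _ (ltnSn m) ne0.
by exists z; split=> //; exact: sub.
Qed.

(* Cells of equal level with indices equal mod 3 have disjoint triples; levels
   equal mod 4 differ by a factor 16, too much for overlapping triples. *)
Lemma maximal_cell_color m j m' j' x : maximal_cell m j -> maximal_cell m' j' ->
  (m %% 4 = m' %% 4)%N -> (j %% 3)%Z = (j' %% 3)%Z ->
  (j%:~R - 1) * scale m < x < (j%:~R + 2) * scale m ->
  (j'%:~R - 1) * scale m' < x < (j'%:~R + 2) * scale m' -> (m, j) = (m', j').
Proof.
wlog : m m' j j' / (m <= m')%N => [wl|].
  case: (leqP m m') => [|/ltnW] mm' M M' E E' X X'; first exact: wl.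
  by apply/esym/wl.
move=> mm' M M' E E' X X'.
have [mm|mm] := eqVneq m m'.
  rewrite mm in X *; congr pair.
  have := scale_gt0 m'; move: X X'; move: (scale m') => h /andP[x1 x2] /andP[x3 x4] h0.
  have : j < j' + 3.
    by rewrite -(ltr_int R) intrD -(ltr_pM2r h0); lra.
  have : j' < j + 3.
    by rewrite -(ltr_int R) intrD -(ltr_pM2r h0); lra.
  by lia.
have [k mk] : exists k, m' = (m + 4 + k)%N.
  by exists (m' - m - 4)%N; lia.
(* The finer cell has a point [z] outside [O] less than 7 of its lengths from [x]. This is less than
   one length of the coarser cell, so [z] falls in the coarser fat cell, which is contained in
   [O]. *)
exfalso; have [z [Oz Z]] : exists z, ~ O z /\
    (j'%:~R - 5) * scale m' < z < (j'%:~R + 6) * scale m'.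
  by rewrite mk addnAC addnS in M' *; exact: maximal_cell_near_compl M'.
apply: Oz; apply: M.1; rewrite /fat_cell /=.
have : 16 * scale m' <= scale m.
  rewrite (scaleD m (4 + k)) addnA -mk ler_pM2r ?scale_gt0// exprD.
  have : 1 <= 2 ^+ k :> R by rewrite exprn_ege1// ler1n.
  by move: (2 ^+ k) => K; lra.
have := scale_gt0 m'; move: X X' Z; move: (scale m) (scale m') => H h.
move=> /andP[x1 x2] /andP[x3 x4] /andP[z1 z2] h0 h16; apply/andP; split; lra.
Qed.

(** Off the countable set of grid points, [x] lies in a cell of every level. Fine enough fat cells
    around [x] fit in [O], and the least level at which this happens gives a maximal cell. *)
Lemma ae_maximal_cell : open O ->
  {ae mu, forall x, O x -> exists m j, maximal_cell m j /\ cell m j x}.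
Proof.
move=> oO; pose E : set R := range (fun p : nat * int => p.2%:~R * scale p.1).
have cE : countable E by apply: (card_le_trans (card_image_le _ _)); exact: countableP.
exists E; split.
- apply: (@countable_measurable _ (measurableTypeR R)) => //.
- exact: countable_lebesgue_measure0.
move=> x /= /not_implyP[Ox nex]; apply: contrapT => nE; apply: nex.
have cellx m : cell m (Num.floor (x / scale m)) x.
  have h0 := scale_gt0 m; have := floor_itv (x / scale m).
  rewrite intrD mulr1z => /andP[f1 f2]; apply/andP; split.
    rewrite -ltr_pdivlMr// lt_neqAle f1 andbT; apply/eqP => xE; apply: nE.
    by exists (m, Num.floor (x / scale m)) => //=; rewrite xE divfK// gt_eqF.
  by rewrite -ltr_pdivrMr.
have [e /= e0 Be] : exists2 e, 0 < e & ball x e `<=` O.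
  by have /nbhs_ballP[e e0 Be] := oO _ Ox; exists e.
have ex : exists m, `[< exists j, cell m j x /\ fat_cell m j `<=` O >].
  (* Points of a fat cell are within 3 cell lengths of any point of the cell, so [3 * scale m < e]
     is enough. *)
  exists (Num.bound (3 * s / e)); apply/asboolP.
  set m := Num.bound _; exists (Num.floor (x / scale m)); split=> //.
  have h3 : 3 * scale m < e.
    rewrite /scale mulrA ltr_pdivrMr ?exprn_gt0// [ltRHS]mulrC -ltr_pdivrMr//.
    exact: upper_nthrootP.
  move=> z Fz; apply: Be; move: (cellx m) Fz h3; rewrite /cell /fat_cell /ball /=.
  move: (scale m) (scale_gt0 m) => h h0.
  move=> /andP[x1 x2] /andP[z1 z2] he; rewrite ltr_norml; apply/andP; split; lra.
case: (ex_minnP ex) => m /asboolP[j [Cx Fj]] min.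
(* A coarser cell meeting this one contains it, hence contains [x], and would contradict minimality
   of the level. *)
exists m, j; split=> //; split=> // m' j' mm' ne0 Fj'.
have : (m <= m')%N.
  apply: min; apply/asboolP; exists j'; split=> //.
  exact: (cell_nested (ltnW mm') ne0).
by rewrite leqNgt mm'.
Qed.

(** A fat cell of level 0 has length [5 s], too long to fit in [O]. Hence every maximal cell has a
    parent. *)
Lemma maximal_cell_level_gt0 m j : measurable (O : set (measurableTypeR R)) ->
  (mu O < s%:E)%E -> maximal_cell m j -> (0 < m)%N.
Proof.
move=> mO muO [P _]; rewrite lt0n; apply/negP => /eqP m0; move: P; rewrite m0.
have -> : fat_cell 0 j = `](j%:~R - 2) * scale 0, (j%:~R + 3) * scale 0[%classic.
  by apply/seteqP; split => x; rewrite /fat_cell /= in_itv.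
rewrite /scale expr0 divr1 => P.
have le : (mu [set` `]((j%:~R - 2) * s)%R, ((j%:~R + 3) * s)%R[] <= mu O)%E.
  by apply: le_measure => //; rewrite inE.
have := le_lt_trans le muO.
rewrite lebesgue_measure_itv/= lte_fin ltr_pM2r// ltrD2l.
have -> : -2 < 3 :> R by lra.
rewrite /= -EFinD lte_fin -mulrBl => hs; have := s0; nra.
Qed.

End whitney.

Lemma whitney_decomposition (R : realType) (O : set R) :
  open O -> measurable (O : set (measurableTypeR R)) ->
  (@lebesgue_measure R O < +oo)%E ->
  exists (a c : nat -> R) (col : nat -> 'I_4 * 'I_3),
  [/\ forall n, a n <= c n,
      forall n k, n <> k -> `]a n, c n[ `&` `]a k, c k[ = set0,
      forall n k x, n <> k -> col n = col k ->
        triple (a n) (c n) x -> ~ triple (a k) (c k) x &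
      [/\ forall n, `]a n, c n[ `<=` O,
      forall n, a n < c n -> exists z, ~ O z /\
        forall x, x \in `]a n, c n[ -> `|z - x| <= 6 * (c n - a n) &
      {ae @lebesgue_measure R, forall x, O x -> exists n, x \in `]a n, c n[}]].
Proof.
move=> oO mO Ofin; pose s := fine (lebesgue_measure O) + 1.
have s0 : 0 < s by rewrite ltr_wpDl// fine_ge0.
have Os : (@lebesgue_measure R O < s%:E)%E.
  by rewrite -[ltLHS]fineK ?ge0_fin_numE// lte_fin ltrDl.
(* Maximal cells are indexed by their codes; every other index receives the degenerate interval from
   0 to 0, whose triple is empty as well. *)
pose idx n : option (nat * int) := if pickle_inv n is Some p then
  if `[< maximal_cell s O p.1 p.2 >] then Some p else None else None.
have idxP n p : idx n = Some p -> maximal_cell s O p.1 p.2 /\ pickle p = n.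
  rewrite /idx; have := @pickle_invK (nat * int)%type n.
  case: pickle_inv => [q /= <-|//]; case: asboolP => // M [<-].
  by split.
pose a n := if idx n is Some p then p.2%:~R * scale s p.1 else 0.
pose c n := if idx n is Some p then (p.2%:~R + 1) * scale s p.1 else 0.
pose col n : 'I_4 * 'I_3 := if idx n is Some p then
  (inord (p.1 %% 4), inord `|(p.2 %% 3)%Z|) else (ord0, ord0).
have ac n : idx n = None -> `]a n, c n[%classic = set0 /\ triple (a n) (c n) = set0.
  rewrite /a /c /triple => ->; rewrite !subrr addr0.
  by rewrite set_itv_ge ?bnd_simp ?ltxx.
have acE n p : idx n = Some p -> `]a n, c n[%classic = cell s p.1 p.2.
  by rewrite /a /c => ->; apply/seteqP; split => x; rewrite /cell /= in_itv.
have wE n p : idx n = Some p -> c n - a n = scale s p.1.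
  by rewrite /a /c => ->; rewrite mulrDl mul1r addrC addKr.
exists a, c, col; split.
- move=> n; rewrite /a /c; case: (idx n) => // p.
  by rewrite ler_pM2r ?scale_gt0// lerDl.
- move=> n k nk; case En : (idx n) => [p|]; last by rewrite (ac _ En).1 set0I.
  case Ek : (idx k) => [q|]; last by rewrite (ac _ Ek).1 setI0.
  have [Mp pn] := idxP _ _ En; have [Mq qk] := idxP _ _ Ek.
  rewrite (acE _ _ En) (acE _ _ Ek); apply: maximal_cell_disjoint Mp Mq _ => //.
  case=> e1 e2; apply: nk.
  by rewrite -pn -qk (surjective_pairing p) (surjective_pairing q) e1 e2.
- move=> n k x nk; case En : (idx n) => [p|]; last by rewrite (ac _ En).2 => _ [].
  case Ek : (idx k) => [q|]; last by rewrite (ac _ Ek).2 => _ _ [].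
  have [Mp pn] := idxP _ _ En; have [Mq qk] := idxP _ _ Ek.
  rewrite /triple (wE _ _ En) (wE _ _ Ek) /a /c /col En Ek => -[c1 c2] Tn Tk.
  apply: nk; rewrite -pn -qk; congr pickle.
  rewrite (surjective_pairing p) (surjective_pairing q).
  apply: (maximal_cell_color s0 Mp Mq (x := x)).
  + by move: (congr1 val c1) => /=; rewrite !inordK ?ltn_mod.
  + by move: (congr1 val c2) => /=; rewrite !inordK; lia.
  + by move: Tn; rewrite /= in_itv/= mulrBl mulrDl mul1r -addrA -mulr2n -[_ *+ 2]mulr_natl -mulrDl.
  + by move: Tk; rewrite /= in_itv/= mulrBl mulrDl mul1r -addrA -mulr2n -[_ *+ 2]mulr_natl -mulrDl.
split.
- move=> n; case En : (idx n) => [p|]; last by rewrite (ac _ En).1.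
  have [[Fp _] _] := idxP _ _ En; rewrite (acE _ _ En); apply: subset_trans Fp.
  move=> x; rewrite /cell /fat_cell /=.
  move: (scale s p.1) (scale_gt0 s0 p.1) (p.2%:~R) => h h0 J /andP[x1 x2].
  by apply/andP; split; nra.
- move=> n; case En : (idx n) => [p|]; last by rewrite /a /c En ltxx.
  move=> _; rewrite (wE _ _ En).
  (* The point [z] comes from the parent's fat cell, between [j - 5] and [j + 6] in units of the
     cell; this is the source of the factor 6. *)
  have [Mp _] := idxP _ _ En.
  have := maximal_cell_level_gt0 s0 mO Os Mp; case: p En Mp => [[|m] j]// En Mp _.
  have [z [Oz Z]] := maximal_cell_near_compl s0 Mp; exists z; split=> // x.
  rewrite in_itv /a /c En /=; move: Z.
  rewrite ler_norml; move: (scale s m.+1) (scale_gt0 s0 m.+1) => h h0.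
  by move: (j%:~R) => J /andP[z1 z2] /andP[x1 x2]; apply/andP; split; nra.
- have [E [mE E0 sub]] := ae_maximal_cell s0 oO; exists E; split=> //.
  apply: subset_trans sub; apply: subsetC => x Px Ox.
  have [m [j [M C]]] := Px Ox; exists (pickle (m, j)).
  have Emj : idx (pickle (m, j)) = Some (m, j).
    by rewrite /idx pickleK_inv; case: asboolP.
  by have := acE _ _ Emj; move=> /seteqP[_ /(_ x C)].
Qed.

(** * Exceptional set of the maximal function *)

(** The set is the superlevel set of the maximal function, open by lower semicontinuity, and 3 is
    the constant of the maximal inequality. Outside it all centred averages are at most [t], and
    Lebesgue differentiation passes this bound to [F]. *)
Lemma exceptional_set (R : realType) (F : R -> R) (t : R) :
  (@lebesgue_measure R).-integrable setT (EFin \o F) ->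
  (forall x, 0 <= F x) -> 0 < t ->
  exists O : set R, [/\ open O, measurable (O : set (measurableTypeR R)),
    (@lebesgue_measure R O <= (3 / t)%:E * \int[@lebesgue_measure R]_x (F x)%:E)%E,
    forall z r, ~ O z -> 0 < r ->
      (\int[@lebesgue_measure R]_(x in ball z r) (F x)%:E <= (2 * r * t)%:E)%E &
    {ae @lebesgue_measure R, forall x, ~ O x -> F x <= t}].
Proof.
move=> iF F0 t0.
have locF : locally_integrable setT F by apply: open_integrable_locally => //; exact: openT.
pose O := [set x | (t%:E < HL_maximal F x)%E].
have mO : measurable (O : set (measurableTypeR R)).
  rewrite -[X in measurable X]setTI; apply: emeasurable_fun_o_infty => //.
  exact: measurable_HL_maximal.
have ballO z r : ~ O z -> 0 < r ->
    (\int[@lebesgue_measure R]_(x in ball z r) (F x)%:E <= (2 * r * t)%:E)%E.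
  move=> /negP; rewrite -leNgt => HLt r0.
  have : (iavg F (ball z r) <= t%:E)%E.
    apply: le_trans HLt; apply: ereal_sup_ubound; exists r => //=.
    by rewrite in_itv/= r0.
  rewrite /iavg lebesgue_measure_ball; last exact: ltW.
  rewrite inver mulrn_eq0/= gt_eqF// lee_pdivrMl ?mulrn_wgt0//.
  under eq_integral do rewrite /= ger0_norm//.
  by rewrite -EFinM -[r *+ 2]mulr_natl.
exists O; split => //.
- by have /lower_semicontinuousP := lower_semicontinuous_HL_maximal locF; exact.
- have := maximal_inequality locF t0; congr (_ <= _ * _)%E.
  by apply: eq_integral => x _; rewrite /= ger0_norm.
pose E (x : R) (n : nat) := ball x n.+1%:R^-1.
have nE x : nicely_shrinking x (E x).
  split=> [n|]; first exact: measurable_ball.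
  have d0 n : 0 < n.+1%:R^-1 :> R by rewrite invr_gt0.
  exists (1, fun n => PosNum (d0 n)); split=> //= [||n].
  - exact: cvg_harmonic.
  - by move=> n; exact: subset_refl.
  - by rewrite mul1e.
have [N [mN N0 sub]] := lebesgue_differentiation locF.
exists N; split=> //; apply: subset_trans sub; apply: subsetC => x Lx Ox.
have cv := nice_lebesgue_differentiation nE locF Lx.
rewrite -lee_fin -(cvg_lim _ cv)//; apply: lime_le; first by apply/cvg_ex; eexists; exact: cv.
apply: nearW => n; rewrite /E lebesgue_measure_ball ?invr_ge0//.
rewrite inver mulrn_eq0/= gt_eqF ?invr_gt0// lee_pdivrMl ?mulrn_wgt0 ?invr_gt0//.
apply: le_trans (ballO _ n.+1%:R^-1 Ox _) _; rewrite ?invr_gt0//.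
by rewrite -EFinM lee_fin mulr_natl.
Qed.

(** * One interval *)

Section complex_valued.
Context (R : realType).
Notation mu := (@lebesgue_measure R).
Notation TR := (measurableTypeR R).
Implicit Types (I T : set R) (f h w : R -> R * R) (F : R -> R).

Lemma restrE I f x : restr I f x = if x \in I then f x else (0, 0).
Proof.
by rewrite /restr; case: asboolP => Ix; [rewrite mem_set|rewrite memNset].
Qed.

Lemma restr_fst I f x : (restr I f x).1 = ((fun y => (f y).1) \_ I) x.
Proof. by rewrite restrE patchE; case: ifP. Qed.

Lemma restr_snd I f x : (restr I f x).2 = ((fun y => (f y).2) \_ I) x.
Proof. by rewrite restrE patchE; case: ifP. Qed.

Lemma restrT I f x : I x -> restr I f x = f x.
Proof. by rewrite /restr; case: asboolP. Qed.

Lemma restrN I f x : ~ I x -> restr I f x = (0, 0).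
Proof. by rewrite /restr; case: asboolP. Qed.

Lemma cmod_ge0 (z : R * R) : 0 <= cmod z.
Proof. exact: sqrtr_ge0. Qed.

Lemma cmod_sqr (z : R * R) : cmod z ^+ 2 = z.1 ^+ 2 + z.2 ^+ 2.
Proof. by rewrite sqr_sqrtr// addr_ge0// sqr_ge0. Qed.

Lemma cmod0 : cmod (0, 0) = 0 :> R.
Proof. by rewrite /cmod /= expr0n addr0 sqrtr0. Qed.

Lemma fst_le_cmod (z : R * R) : `|z.1| <= cmod z.
Proof. by rewrite -sqrtr_sqr ler_wsqrtr// lerDl sqr_ge0. Qed.

Lemma snd_le_cmod (z : R * R) : `|z.2| <= cmod z.
Proof. by rewrite -sqrtr_sqr ler_wsqrtr// lerDr sqr_ge0. Qed.

Lemma cmod_le (z : R * R) : cmod z <= `|z.1| + `|z.2|.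
Proof.
rewrite -(ler_pXn2r (n := 2)) ?nnegrE ?cmod_ge0 ?addr_ge0// cmod_sqr.
by rewrite sqrrD !real_normK ?num_real// lerD2r lerDl mulrn_wge0// mulr_ge0.
Qed.

Lemma measurable_cmod h : cmeasurable h ->
  measurable_fun (setT : set TR) (fun x => cmod (h x)).
Proof.
move=> [m1 m2].
have msqrt : measurable_fun (setT : set TR) (@Num.sqrt R).
  by apply: continuous_measurable_fun; exact: sqrt_continuous.
apply: (measurableT_comp msqrt).
by apply: measurable_funD; apply: measurable_funX.
Qed.

Lemma measurable_cmod_sqr h : cmeasurable h ->
  measurable_fun (setT : set TR) (fun x => ((cmod (h x)) ^+ 2)%:E).
Proof.
by move=> mh; apply/measurable_EFinP; apply: measurable_funX; exact: measurable_cmod.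
Qed.

Lemma cintegrable_cmeasurable f : cintegrable f -> cmeasurable f.
Proof.
by move=> [i1 i2]; split; apply/measurable_EFinP;
  [exact: measurable_int i1|exact: measurable_int i2].
Qed.

Lemma integrable_cmod f : cintegrable f -> rintegrable mu setT (fun x => cmod (f x)).
Proof.
move=> cf; have [i1 i2] := cf.
have iS := integrableD measurableT (integrable_abse i1) (integrable_abse i2).
apply: (le_integrable measurableT _ _ iS).
  by apply/measurable_EFinP; exact: measurable_cmod (cintegrable_cmeasurable cf).
move=> x _; rewrite /= lee_fin ger0_norm ?cmod_ge0// ger0_norm ?addr_ge0//.
exact: cmod_le.
Qed.

Lemma L1norm_restr I f : measurable (I : set TR) ->
  L1norm (restr I f) = (\int[mu]_(x in I) (cmod (f x))%:E)%E.
Proof.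
move=> mI; rewrite [RHS]integral_mkcond /L1norm; apply: eq_integral => x _.
by rewrite restrE patchE; case: ifP => //= _; rewrite cmod0.
Qed.

Lemma cmeasurable_restr I w : measurable (I : set TR) -> cmeasurable w ->
  cmeasurable (restr I w).
Proof.
move=> mI [m1 m2]; split.
  under [X in measurable_fun _ X]funext do rewrite restr_fst.
  by apply/(measurable_restrictT _ mI); exact: measurable_funTS.
under [X in measurable_fun _ X]funext do rewrite restr_snd.
by apply/(measurable_restrictT _ mI); exact: measurable_funTS.
Qed.

Lemma cmeasurable_csub f h : cmeasurable f -> cmeasurable h -> cmeasurable (csub f h).
Proof.
by move=> [f1 f2] [h1 h2]; split; exact: measurable_funB.
Qed.

Lemma csubKl f h : csub f (csub f h) = h.
Proof. by apply/funext => x; rewrite /csub/= !subKr; case: (h x). Qed.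

(** Used with [p] a cosine or a sine; the resulting zero integrals combine into [fourier_re] and
    [fourier_im]. *)
Lemma cut_integral I T (F G p : R -> R) :
  measurable (I : set TR) -> measurable (T : set TR) ->
  rintegrable mu I (fun x => F x * p x) -> rintegrable mu T (fun x => G x * p x) ->
  \int[mu]_(x in T) (G x * p x) = \int[mu]_(x in I) (F x * p x) ->
  mu.-integrable setT (fun x => (((F \_ I) x - (G \_ T) x) * p x)%:E) /\
  (\int[mu]_x (((F \_ I) x - (G \_ T) x) * p x)%:E = 0)%E.
Proof.
move=> mI mT iF iG E.
have eq1 (D : set R) (H : R -> R) :
    (fun x => ((H \_ D) x * p x)%:E) = ((EFin \o (fun x => H x * p x)) \_ D).
  by apply/funext => x; rewrite !patchE; case: ifP => // _; rewrite mul0r.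
have iF' : mu.-integrable setT (fun x => ((F \_ I) x * p x)%:E).
  by rewrite eq1 -integrable_mkcond.
have iG' : mu.-integrable setT (fun x => ((G \_ T) x * p x)%:E).
  by rewrite eq1 -integrable_mkcond.
under [X in _.-integrable _ X]funext do rewrite mulrBl.
split; first exact: (integrableB measurableT iF' iG').
under eq_integral do rewrite mulrBl.
rewrite (integralB_EFin measurableT iF' iG') !eq1 -!integral_mkcond.
rewrite -(fineK (integrable_fin_num mI iF)) -(fineK (integrable_fin_num mT iG)).
by move: E; rewrite /Rintegral => ->; rewrite -EFinD subrr.
Qed.

(** Real and imaginary parts each cost the factor 4 of [trig_projection], whence 8. *)
Lemma frequency_block (N : nat) (xi : 'I_N -> R) f (a c : R) :
  (0 < N)%N -> a <= c -> cintegrable f ->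
  exists w, let b := csub (restr `]a, c[ f) (restr (triple a c) w) in
  [/\ cmeasurable w,
      (L2norm2 (restr (triple a c) w) <=
        (8 * N%:R / (c - a) * fine (L1norm (restr `]a, c[ f)) ^+ 2)%:E)%E,
      cintegrable b &
      forall j, fourier_re b (xi j) = 0%E /\ fourier_im b (xi j) = 0%E].
Proof.
move=> N0 ac cf; have [i1 i2] := cf.
have mI : measurable (`]a, c[ : set TR) by [].
have mT : measurable (triple a c : set TR) by exact: measurable_itv.
have r1 : rintegrable mu `]a, c[ (fun x => (f x).1) by exact: integrableS i1.
have r2 : rintegrable mu `]a, c[ (fun x => (f x).2) by exact: integrableS i2.
have [B1 [B2 [e1 e2 n12]]] : exists B1 B2 : 'rV[R]_(N + N), [/\
    forall i, \int[mu]_(x in triple a c) (comb (trig xi) B1 x * trig xi i x) =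
               \int[mu]_(x in `]a, c[) ((f x).1 * trig xi i x),
    forall i, \int[mu]_(x in triple a c) (comb (trig xi) B2 x * trig xi i x) =
               \int[mu]_(x in `]a, c[) ((f x).2 * trig xi i x) &
    \int[mu]_(x in triple a c) comb (trig xi) B1 x ^+ 2 +
    \int[mu]_(x in triple a c) comb (trig xi) B2 x ^+ 2 <=
      8 * N%:R / (c - a) * fine (L1norm (restr `]a, c[ f)) ^+ 2].
  move: ac; rewrite le_eqVlt => /predU1P[E|ac].
    (* On an empty interval zero coefficients work, and division by zero makes the right-hand bound
       0. *)
    exists 0, 0; rewrite /triple E subrr subr0 addr0 set_itv_ge ?bnd_simp ?ltxx//.
    split=> [i|i|]; rewrite ?Rintegral_set0//.
    by rewrite invr0 mulr0 mul0r addr0.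
  have [B1 [e1 n1]] := trig_projection xi N0 ac r1.
  have [B2 [e2 n2]] := trig_projection xi N0 ac r2.
  exists B1, B2; split=> //.
  have rF : rintegrable mu `]a, c[ (fun x => cmod (f x)).
    by apply: integrableS (integrable_cmod cf).
  have q (p : R * R -> R) : (forall z, `|p z| <= cmod z) ->
      rintegrable mu `]a, c[ (fun x => p (f x)) ->
      (\int[mu]_(x in `]a, c[) `|p (f x)|) ^+ 2 <= fine (L1norm (restr `]a, c[ f)) ^+ 2.
    move=> pc ip; rewrite L1norm_restr// ler_pXn2r ?nnegrE//; last 2 first.
      by apply: Rintegral_ge0.
      by rewrite fine_ge0// integral_ge0// => x _; rewrite lee_fin cmod_ge0.
    by apply: le_Rintegral => //; exact: integrable_norm.
  have K0 : 0 <= 4 * N%:R / (c - a) by rewrite divr_ge0 ?mulr_ge0// subr_ge0 ltW.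
  have := ler_wpM2l K0 (q fst fst_le_cmod r1); have := ler_wpM2l K0 (q snd snd_le_cmod r2).
  have -> : 8 * N%:R / (c - a) = 4 * N%:R / (c - a) + 4 * N%:R / (c - a) :> R by ring.
  by move=> q1 q2; rewrite mulrDl lerD// ?(le_trans n1)// (le_trans n2).
pose w x := (comb (trig xi) B1 x, comb (trig xi) B2 x).
have mw : cmeasurable w.
  by split; apply: continuous_measurable_fun; exact: continuous_comb.
have ic B : rintegrable mu (triple a c) (fun x => comb (trig xi) B x ^+ 2).
  by apply: continuous_rintegrable => x; apply: continuousM; exact: continuous_comb.
have it i B : rintegrable mu (triple a c) (fun x => comb (trig xi) B x * trig xi i x).
  apply: continuous_rintegrable => x; apply: continuousM;
    [exact: continuous_comb|exact: continuous_trig].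
have iI i F : rintegrable mu `]a, c[ F -> rintegrable mu `]a, c[ (fun x => F x * trig xi i x).
  move=> iF; apply: (integrableMl _ iF) => //.
    by apply: measurable_funTS; apply: continuous_measurable_fun; exact: continuous_trig.
  by exists 1; split=> // M M1 y _; apply: le_trans (trig_bound _ _ _) (ltW M1).
have cut1 i := cut_integral mI mT (iI i _ r1) (it i B1) (e1 i).
have cut2 i := cut_integral mI mT (iI i _ r2) (it i B2) (e2 i).
exists w => b.
have b1 x : (b x).1 = ((fun y => (f y).1) \_ `]a, c[) x - (comb (trig xi) B1 \_ (triple a c)) x.
  by rewrite /b /csub /= !restr_fst.
have b2 x : (b x).2 = ((fun y => (f y).2) \_ `]a, c[) x - (comb (trig xi) B2 \_ (triple a c)) x.
  by rewrite /b /csub /= !restr_snd.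
split=> //.
- rewrite /L2norm2.
  have -> : (fun x => (cmod (restr (triple a c) w x) ^+ 2)%:E) =
      (EFin \o (fun x => comb (trig xi) B1 x ^+ 2 + comb (trig xi) B2 x ^+ 2)) \_ (triple a c).
    by apply/funext => x; rewrite cmod_sqr restrE patchE; case: ifP => //= _; rewrite expr0n addr0.
  rewrite -integral_mkcond.
  have iD := rintegrableD mT (ic B1) (ic B2).
  rewrite -(fineK (integrable_fin_num mT iD)) lee_fin.
  by rewrite -/(Rintegral mu (triple a c) _) RintegralD//; [exact: ic|exact: ic].
- have i0 B : rintegrable mu (triple a c) (comb (trig xi) B).
    by apply: continuous_rintegrable; exact: continuous_comb.
  have patchi F (D : set R) : measurable (D : set TR) -> rintegrable mu D F ->
      rintegrable mu setT (F \_ D).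
    by move=> mD; rewrite /rintegrable integrable_mkcond// restrict_EFin.
  split.
    under [X in _.-integrable _ X]funext do rewrite b1.
    exact: (rintegrableB measurableT (patchi _ _ mI r1) (patchi _ _ mT (i0 _))).
  under [X in _.-integrable _ X]funext do rewrite b2.
  exact: (rintegrableB measurableT (patchi _ _ mI r2) (patchi _ _ mT (i0 _))).
move=> j; split.
- rewrite /fourier_re.
  have [ia za] := cut1 (lshift N j); have [ib zb] := cut2 (rshift N j).
  under eq_integral do rewrite b1 b2 -trig_cos -trig_sin.
  by rewrite (integralB_EFin measurableT ia ib) za zb sube0.
- rewrite /fourier_im.
  have [ia za] := cut1 (rshift N j); have [ib zb] := cut2 (lshift N j).
  under eq_integral do rewrite b1 b2 -trig_cos -trig_sin.
  by rewrite (integralD_EFin measurableT ia ib) za zb adde0.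
Qed.

End complex_valued.

(** * Summation *)

(** Sum [2 * v c * v e <= v c ^+ 2 + v e ^+ 2] over all pairs. *)
Lemma sqr_sum_le_card (R : realFieldType) (C : finType) (v : C -> R) :
  (\sum_c v c) ^+ 2 <= #|C|%:R * \sum_c v c ^+ 2.
Proof.
have E : \sum_c \sum_e (v c ^+ 2 + v e ^+ 2) = 2 * (#|C|%:R * \sum_c v c ^+ 2).
  under eq_bigr do rewrite big_split /= sumr_const -mulr_natl.
  by rewrite big_split /= sumr_const -mulr_sumr -mulr_natl; ring.
rewrite -(ler_pM2l (ltr0n R 2)) -E expr2 mulr_suml mulr_sumr.
apply: ler_sum => c _; rewrite !mulr_sumr; apply: ler_sum => e _.
by have := sqr_ge0 (v c - v e); rewrite sqrrB; lra.
Qed.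

(** Each colour class has at most one nonzero term, so within a class the square of the sum is the
    sum of squares; only the sum over colours costs a factor. *)
Lemma sqr_sum_colored (R : realFieldType) (C : finType) (col : nat -> C)
    (u : nat -> R) k :
  (forall n m, n <> m -> col n = col m -> u n <> 0 -> u m = 0) ->
  (\sum_(0 <= n < k) u n) ^+ 2 <= #|C|%:R * \sum_(0 <= n < k) u n ^+ 2.
Proof.
move=> h; rewrite !big_mkord.
rewrite (partition_big (fun i : 'I_k => col i) xpredT)//=.
rewrite [X in _ * X](partition_big (fun i : 'I_k => col i) xpredT)//=.
apply: le_trans (sqr_sum_le_card _) _; rewrite ler_wpM2l//.
apply: ler_sum => e _; rewrite le_eqVlt; apply/orP; left; apply/eqP.
have [[i ie ui]|nex] := pselect (exists2 i : 'I_k, col i == e & u i <> 0).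
  have uj (j : 'I_k) : col j == e -> j != i -> u j = 0.
    move=> je ji; apply: (h i j) => //; last by rewrite (eqP ie) (eqP je).
    by move=> /val_inj ij; rewrite ij eqxx in ji.
  rewrite (bigD1 i)//= [RHS](bigD1 i)//= !big1 ?addr0// => j /andP[je ji].
    by rewrite uj// expr0n.
  by rewrite uj.
have u0 (i : 'I_k) : col i == e -> u i = 0.
  by move=> ie; apply: contrapT => ui; apply: nex; exists i.
by rewrite !big1 ?expr0n// => i ie; rewrite u0// expr0n.
Qed.

(** Each of the finitely many colours admits at most one index. Hence a point lies in finitely many
    triples and the series of the bad parts is a finite sum there. *)
Lemma colored_eventually (C : finType) (col : nat -> C) (P : nat -> Prop) :
  (forall n m, n <> m -> col n = col m -> P n -> ~ P m) ->
  exists K, forall n, (K <= n)%N -> ~ P n.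
Proof.
move=> h.
have /choice[g gP] : forall e : C, exists K, forall n, col n = e -> P n -> (n < K)%N.
  move=> e; have [[i ie Pi]|nex] := pselect (exists2 i, col i = e & P i).
    exists i.+1 => n ne Pn; rewrite ltnS leq_eqVlt; apply/orP; left; apply/eqP.
    by apply: contrapT => /(h n i); rewrite ne ie; exact.
  by exists 0%N => n ne Pn; exfalso; apply: nex; exists n.
exists (\max_e g e)%N => n Kn Pn.
have := gP _ _ erefl Pn; rewrite ltnNge; apply/negP; rewrite negbK.
by apply: leq_trans Kn; exact: leq_bigmax.
Qed.

Lemma sum_eventually0 (R : numDomainType) (u : nat -> R) K k :
  (forall n, (K <= n)%N -> u n = 0) -> (K <= k)%N ->
  \sum_(0 <= n < k) u n = \sum_(0 <= n < K) u n.
Proof.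
move=> u0 Kk; rewrite (@big_cat_nat _ _ _ K)//= [X in _ + X]big1_seq ?addr0// => i.
by rewrite mem_index_iota => /andP[_ /andP[Ki _]]; exact: u0.
Qed.

Lemma sum_single (R : numDomainType) (u : nat -> R) K m :
  (forall n, n <> m -> u n = 0) -> (m < K)%N ->
  \sum_(0 <= n < K) u n = u m.
Proof.
move=> u0 mK; rewrite big_mkord (bigD1 (Ordinal mK))//= big1 ?addr0// => i im.
by apply: u0 => E; move: im; rewrite -val_eqE /= E eqxx.
Qed.

(** Here [p] stands for the real or the imaginary part. With [W] the sum of the corrections, the
    remainder is [W] on the union of the [I n] and [p (f x) + W] off it; then
    [(q + W)^2 <= 2 q^2 + 2 W^2], and the colours bound [W^2]. *)
Lemma good_part_pointwise (R : realType) (C : finType) (col : nat -> C)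
    (I T : nat -> set R) (f : R -> R * R) (w : nat -> R -> R * R) (x : R)
    (p : R * R -> R) :
  (p (0, 0) = 0) -> (forall y z : R * R, p (y.1 - z.1, y.2 - z.2) = p y - p z) ->
  (forall n m, n <> m -> I n `&` I m = set0) -> (forall n, I n `<=` T n) ->
  (forall n k, n <> k -> col n = col k -> T n x -> ~ T k x) ->
  let u k := \sum_(0 <= n < k) p (csub (restr (I n) f) (restr (T n) (w n)) x) in
  exists K, (forall k, (K <= k)%N -> u k = u K) /\
    ((p (f x) - u K) ^+ 2 <=
      2 * (if `[< exists n, I n x >] then 0 else p (f x) ^+ 2) +
      2 * #|C|%:R * \sum_(0 <= n < K) p (restr (T n) (w n) x) ^+ 2).
Proof.
move=> p0 pB dI IT cT u.
have [K KP] := colored_eventually cT.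
have pE n : p (csub (restr (I n) f) (restr (T n) (w n)) x) =
    p (restr (I n) f x) - p (restr (T n) (w n) x) by exact: pB.
have b0 n : (K <= n)%N -> p (csub (restr (I n) f) (restr (T n) (w n)) x) = 0.
  move=> Kn; rewrite pE; have nT := KP _ Kn.
  by rewrite !restrN// ?p0 ?subrr// => /IT.
exists K; split; first by move=> k Kk; exact: sum_eventually0 b0 Kk.
have sW : (\sum_(0 <= n < K) p (restr (T n) (w n) x)) ^+ 2 <=
    #|C|%:R * \sum_(0 <= n < K) p (restr (T n) (w n) x) ^+ 2.
  apply: (@sqr_sum_colored _ _ col) => n m nm cnm pn; rewrite restrN//.
  by apply: cT nm cnm _; apply: contrapT => nT; apply: pn; rewrite restrN.
have uE : u K = \sum_(0 <= n < K) p (restr (I n) f x) -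
    \sum_(0 <= n < K) p (restr (T n) (w n) x).
  by rewrite /u -sumrB; apply: eq_bigr => n _; rewrite pE.
(* The parts [f 1_(I n)] cancel [f] on the union of the [I n]. *)
rewrite uE; move: sW; set W := \sum_(0 <= n < K) p (restr (T n) (w n) x).
set W2 := \sum_(0 <= n < K) _ => sW.
rewrite -mulrA; case: asboolP => [[m Im]|nI].
  rewrite (sum_single (m := m)).
  - rewrite restrT// opprB addrC subrK mulr0 add0r.
    by move: sW (sqr_ge0 W); set V := #|C|%:R * W2; lra.
  - move=> n nm; rewrite restrN// => In.
    by have : (I n `&` I m) x by []; rewrite dI.
  - by rewrite ltnNge; apply/negP => /KP; apply; exact: IT.
rewrite big1_seq; last first.
  by move=> n _; rewrite restrN// => In; apply: nI; exists n.
rewrite sub0r opprK; move: sW; set V := #|C|%:R * W2; move: (p (f x)) => q.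
by have := sqr_ge0 (q - W); rewrite sqrrB sqrrD; lra.
Qed.

(** The first power of [cmod (f x)] on the right reflects that [f] is bounded off the exceptional
    set, so its square there is controlled by its L1 norm. *)
Lemma L2norm2_le_series (R : realType) (g f : R -> R * R)
    (h : nat -> R -> R * R) (r s : R) :
  0 <= r -> 0 <= s -> cmeasurable g -> cmeasurable f -> (forall n, cmeasurable (h n)) ->
  {ae @lebesgue_measure R, forall x, ((cmod (g x) ^+ 2)%:E <=
    r%:E * (cmod (f x))%:E + s%:E * \sum_(0 <= n <oo) (cmod (h n x) ^+ 2)%:E)%E} ->
  (L2norm2 g <= r%:E * L1norm f + s%:E * \sum_(0 <= n <oo) L2norm2 (h n))%E.
Proof.
move=> r0 s0 mg mf mh le.
have mf1 : measurable_fun (setT : set (measurableTypeR R)) (fun x => (cmod (f x))%:E).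
  by apply/measurable_EFinP; exact: measurable_cmod.
have mS : measurable_fun (setT : set (measurableTypeR R))
    (fun x => \sum_(0 <= n <oo) (cmod (h n x) ^+ 2)%:E)%E.
  apply: (@ge0_emeasurable_sum _ (measurableTypeR R) _ setT
    (fun n x => (cmod (h n x) ^+ 2)%:E) xpredT).
    by move=> n x _ _; rewrite lee_fin sqr_ge0.
  by move=> n _; exact: measurable_cmod_sqr.
have S0 x : (0 <= \sum_(0 <= n <oo) (cmod (h n x) ^+ 2)%:E)%E.
  by apply: nneseries_ge0 => n _ _; rewrite lee_fin sqr_ge0.
have -> : (\sum_(0 <= n <oo) L2norm2 (h n) =
    \int[@lebesgue_measure R]_x \sum_(0 <= n <oo) (cmod (h n x) ^+ 2)%:E)%E.
  rewrite integral_nneseries//.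
    by move=> n; exact: measurable_cmod_sqr.
  by move=> n x _; rewrite lee_fin sqr_ge0.
have f0 x : (0 <= (cmod (f x))%:E)%E by rewrite lee_fin cmod_ge0.
have -> : (r%:E * L1norm f + s%:E * \int[@lebesgue_measure R]_x
      \sum_(0 <= n <oo) (cmod (h n x) ^+ 2)%:E =
    \int[@lebesgue_measure R]_x (r%:E * (cmod (f x))%:E +
      s%:E * \sum_(0 <= n <oo) (cmod (h n x) ^+ 2)%:E))%E.
  rewrite ge0_integralD//.
  - by rewrite !ge0_integralZl.
  - by move=> x _; rewrite mule_ge0.
  - exact: measurable_funeM.
  - by move=> x _; rewrite mule_ge0.
  - exact: measurable_funeM.
apply: ae_ge0_le_integral => //.
- by move=> x _; rewrite lee_fin sqr_ge0.
- exact: measurable_cmod_sqr.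
- by move=> x _; rewrite adde_ge0// mule_ge0// lee_fin ?cmod_ge0.
- by apply: emeasurable_funD; exact: measurable_funeM.
- case: le => E [mE E0 sub]; exists E; split=> //.
  by apply: subset_trans sub; apply: subsetC => x /=.
Qed.

Lemma sum_itv_length_le (R : realType) (a c : nat -> R) (O : set R) :
  (forall n, a n <= c n) ->
  (forall n k, n <> k -> `]a n, c n[ `&` `]a k, c k[ = set0) ->
  measurable (O : set (measurableTypeR R)) -> (forall n, `]a n, c n[ `<=` O) ->
  (\sum_(0 <= n <oo) (c n - a n)%:E <= @lebesgue_measure R O)%E.
Proof.
move=> ac dI mO IO.
have -> : (\sum_(0 <= n <oo) (c n - a n)%:E)%E =
    (\sum_(0 <= n <oo) @lebesgue_measure R `]a n, c n[%classic)%E.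
  apply: eq_eseriesr => n _; rewrite lebesgue_measure_itv/= lte_fin.
  by have := ac n; rewrite le_eqVlt => /predU1P[->|->]; rewrite ?ltxx ?subrr.
have mI n : measurable (`]a n, c n[%classic : set (measurableTypeR R)) by [].
have mU : measurable (\bigcup_n `]a n, c n[%classic : set (measurableTypeR R)).
  exact: bigcup_measurable.
rewrite -measure_semi_bigcup//; last first.
  by apply/trivIsetP => n k _ _ /eqP nk; exact: dI.
by apply: le_measure; rewrite ?inE// => x [n _] /IO.
Qed.

(** * Assembling the decomposition *)

Theorem theorem1 (R : realType) :
  exists C : R, 0 < C /\
  forall (N : nat) (xi : 'I_N -> R) (f : R -> R * R) (lam : R),
    (1 <= N)%N ->
    (forall i j : 'I_N, (i < j)%N -> xi i < xi j) ->
    cintegrable f -> 0 < lam ->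
    exists (a c : nat -> R) (g : R -> R * R) (b : nat -> R -> R * R),
      (* the intervals I_n = ]a n, c n[ *)
      (forall n, a n <= c n) /\
      (forall n m, n <> m -> `]a n, c n[ `&` `]a m, c m[ = set0) /\
      (* f = g + sum_n b_n  (almost everywhere) *)
      cmeasurable g /\ (forall n, cmeasurable (b n)) /\
      {ae @lebesgue_measure R, forall x,
         ((fun k => \sum_(0 <= n < k) (b n x).1) @ \oo --> (f x).1 - (g x).1) /\
         ((fun k => \sum_(0 <= n < k) (b n x).2) @ \oo --> (f x).2 - (g x).2)} /\
      (\sum_(0 <= n <oo) ((c n - a n)%:E) <=
         (C * Num.sqrt (N%:R) / lam)%:E * L1norm f)%E /\
      (L2norm2 g <= (C * Num.sqrt (N%:R) * lam)%:E * L1norm f)%E /\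
      (forall n,
         (L1norm (restr `]a n, c n[ f) <= (C * (c n - a n) * lam)%:E)%E /\
         (L2norm2 (csub (restr `]a n, c n[ f) (b n))
            <= ((C * Num.sqrt (c n - a n) * lam * Num.sqrt (N%:R)) ^+ 2)%:E)%E /\
         cintegrable (b n) /\
         (forall j : 'I_N, fourier_re (b n) (xi j) = 0%E /\ fourier_im (b n) (xi j) = 0%E) /\
         (forall x, ~ triple (a n) (c n) x -> b n x = (0, 0))).
Proof.
(* The 8 comes from [frequency_block] and the 14 from the L1 bound on one interval. In the final
   constant, 72 is 24 times the 3 of the maximal inequality, and 16 absorbs the remaining terms. *)
have [A [A1 AE]] : exists A : R, 1 <= A /\ A = 8 * 14 ^+ 2.
  by exists (8 * 14 ^+ 2); split=> //; lra.
exists (16 + 72 * A); split; first lra.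
move=> N xi f lam N0 _ cf lam0.
set C := 16 + 72 * A; have [C14 CA] : 14 <= C /\ A <= C by split; rewrite /C; lra.
pose F x := cmod (f x).
have F0 x : 0 <= F x by exact: cmod_ge0.
have iF : (@lebesgue_measure R).-integrable setT (EFin \o F) by exact: integrable_cmod.
set sN := Num.sqrt N%:R.
have sN1 : 1 <= sN by rewrite -[1]sqrtr1 ler_wsqrtr// ler1n.
have sN0 : 0 < sN by lra.
have sN2 : N%:R = sN ^+ 2 by rewrite sqr_sqrtr.
(* This height makes [N t^2 = lam^2], so the factor [N] lost in the projection is compensated, while
   the measure of the exceptional set grows only by the square root of [N]. *)
pose t := lam / sN; have t0 : 0 < t by rewrite divr_gt0.
have lamE : lam = t * sN by rewrite divfK// gt_eqF.
have [nF [nF0 nFE]] : exists nF, 0 <= nF /\ L1norm f = nF%:E.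
  exists (fine (L1norm f)); split.
    by rewrite fine_ge0// integral_ge0// => x _; rewrite lee_fin cmod_ge0.
  by rewrite fineK// (integrable_fin_num _ iF).
have [Om [oO mO muO ballO aeO]] := exceptional_set iF F0 t0.
rewrite -/(L1norm f) nFE -EFinM in muO.
have Ofin : (@lebesgue_measure R Om < +oo)%E by apply: le_lt_trans muO _; rewrite ltry.
have [a [c [col [ac dI cT [IO near aeI]]]]] := whitney_decomposition oO mO Ofin.
have sumI := le_trans (sum_itv_length_le ac dI mO IO) muO.
have d0 n : 0 <= c n - a n by rewrite subr_ge0.
have mI n : measurable (`]a n, c n[ : set (measurableTypeR R)) by [].
have mT n : measurable (triple (a n) (c n) : set (measurableTypeR R)).
  exact: measurable_itv.
have IT n : `]a n, c n[ `<=` triple (a n) (c n).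
  by apply: subset_itv; rewrite bnd_simp; have := ac n; lra.
have L1I n : (L1norm (restr `]a n, c n[ f) <= (14 * (c n - a n) * t)%:E)%E.
  rewrite L1norm_restr//; have := ac n; rewrite le_eqVlt => /predU1P[E|acn].
    rewrite E set_itv_ge ?bnd_simp ?ltxx// integral_set0 lee_fin subrr.
    by rewrite mulr0 mul0r.
  have [z [Oz zI]] := near n acn.
  (* Every point of the interval is within 6 lengths of [z], so the open ball of radius 7 lengths
     contains it; its diameter gives 14. *)
  have dn : 0 < 7 * (c n - a n) by rewrite mulr_gt0// subr_gt0.
  have -> : 14 * (c n - a n) * t = 2 * (7 * (c n - a n)) * t by ring.
  apply: le_trans (ballO z _ Oz dn); apply: ge0_subset_integral => //.
  - exact: measurable_ball.
  - by apply: measurable_funTS; exact: (measurable_int _ iF).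
  - by move=> x _; rewrite lee_fin cmod_ge0.
  - by move=> x /zI zx; rewrite /ball /=; apply: le_lt_trans zx _; lra.
have L1f n : L1norm (restr `]a n, c n[ f) = (fine (L1norm (restr `]a n, c n[ f)))%:E.
  rewrite fineK// ge0_fin_numE; first by apply: le_lt_trans (L1I n) _; rewrite ltry.
  by apply: integral_ge0 => x _; rewrite lee_fin cmod_ge0.
have /choice[w wP] := fun n => frequency_block xi N0 (ac n) cf.
pose b n := csub (restr `]a n, c n[ f) (restr (triple (a n) (c n)) (w n)).
have mw n : cmeasurable (restr (triple (a n) (c n)) (w n)).
  by apply: cmeasurable_restr => //; case: (wP n).
have mb n : cmeasurable (b n).
  apply: cmeasurable_csub => //; apply: cmeasurable_restr => //.
  exact: cintegrable_cmeasurable.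
have L2w n : (L2norm2 (restr (triple (a n) (c n)) (w n)) <=
    (A * (c n - a n) * lam ^+ 2)%:E)%E.
  have [_ le _ _] := wP n; apply: le_trans le _; rewrite lee_fin.
  have [->|dn] := eqVneq (c n - a n) 0; first by rewrite invr0 !mulr0 !mul0r.
  have dp : 0 < c n - a n by rewrite lt_neqAle eq_sym dn d0.
  have := L1I n; rewrite L1f lee_fin; set q := fine _ => q14.
  have q0 : 0 <= q by rewrite fine_ge0// integral_ge0// => x _; rewrite lee_fin cmod_ge0.
  have -> : A * (c n - a n) * lam ^+ 2 =
      8 * N%:R / (c n - a n) * (14 * (c n - a n) * t) ^+ 2.
    by rewrite AE lamE sN2; field.
  rewrite ler_wpM2l ?divr_ge0 ?mulr_ge0// ler_pXn2r// nnegrE//.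
  by rewrite mulr_ge0 ?(ltW t0)// mulr_ge0.
(* The factor 24 is twice the number of colours. *)
have key (p : R * R -> R) x : p (0, 0) = 0 ->
  (forall y z : R * R, p (y.1 - z.1, y.2 - z.2) = p y - p z) ->
  exists K, (forall k, (K <= k)%N ->
      \sum_(0 <= n < k) p (b n x) = \sum_(0 <= n < K) p (b n x)) /\
    ((p (f x) - \sum_(0 <= n < K) p (b n x)) ^+ 2 <=
      2 * (if `[< exists n, `]a n, c n[%classic x >] then 0 else p (f x) ^+ 2) +
      24 * \sum_(0 <= n < K) p (restr (triple (a n) (c n)) (w n) x) ^+ 2).
  move=> p0 pB; have cTx n k nk ck := cT n k x nk ck.
  have [K [K1 K2]] := good_part_pointwise f w p0 pB dI IT cTx.
  exists K; split=> //; move: K2.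
  by rewrite card_prod !card_ord (_ : 2 * (4 * 3)%:R = 24 :> R)// -natrM.
have key1 x := key fst x erefl (fun _ _ => erefl).
have key2 x := key snd x erefl (fun _ _ => erefl).
have /choice[K1 K1P] := key1; have /choice[K2 K2P] := key2.
(* The cut-offs depend on the point, so measurability of [g] is obtained from the limit of the
   partial sums. *)
pose g x := ((f x).1 - \sum_(0 <= n < K1 x) (b n x).1,
             (f x).2 - \sum_(0 <= n < K2 x) (b n x).2).
have cv1 x : (fun k => \sum_(0 <= n < k) (b n x).1) @ \oo --> (f x).1 - (g x).1.
  rewrite /g /= subKr; apply: cvg_near_cst; exists (K1 x) => // k /= Kk.
  exact: (K1P x).1.
have cv2 x : (fun k => \sum_(0 <= n < k) (b n x).2) @ \oo --> (f x).2 - (g x).2.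
  rewrite /g /= subKr; apply: cvg_near_cst; exists (K2 x) => // k /= Kk.
  exact: (K2P x).1.
have [mf1 mf2] := cintegrable_cmeasurable cf.
have mg : cmeasurable g.
  split.
    have -> : (fun x => (g x).1) = (fun x => (f x).1 - ((f x).1 - (g x).1)).
      by apply/funext => x; rewrite subKr.
    apply: measurable_funB => //; apply: measurable_fun_cvg (fun x _ => cv1 x).
    by move=> k; apply: measurable_sum => n; exact: (mb n).1.
  have -> : (fun x => (g x).2) = (fun x => (f x).2 - ((f x).2 - (g x).2)).
    by apply/funext => x; rewrite subKr.
  apply: measurable_funB => //; apply: measurable_fun_cvg (fun x _ => cv2 x).
  by move=> k; apply: measurable_sum => n; exact: (mb n).2.
have L2g : (L2norm2 g <= (C * sN * lam)%:E * L1norm f)%E.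
  have cmf : cmeasurable f by exact: cintegrable_cmeasurable.
  have t20 : 0 <= 2 * t by rewrite mulr_ge0// ltW.
  apply: le_trans (L2norm2_le_series t20 (ler0n R 24) mg cmf mw _) _.
    case: aeI => E1 [mE1 E10 sub1]; case: aeO => E2 [mE2 E20 sub2].
    exists (E1 `|` E2); split; [exact: measurableU|exact: null_set_setU|].
    rewrite -[E1 `|` E2]setCK; apply: subsetC => x.
    rewrite setCU => -[/(subsetCl sub1) nx1 /(subsetCl sub2) nx2].
    have [_ b1] := K1P x; have [_ b2] := K2P x.
    set S1 := \sum_(0 <= n < K1 x) _ ^+ 2 in b1.
    set S2 := \sum_(0 <= n < K2 x) _ ^+ 2 in b2.
    have S12 : ((S1 + S2)%:E <= \sum_(0 <= n <oo)
        (cmod (restr (triple (a n) (c n)) (w n) x) ^+ 2)%:E)%E.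
      have inc (u : nat -> R) K L : (forall n, 0 <= u n) -> (K <= L)%N ->
          \sum_(0 <= n < K) u n <= \sum_(0 <= n < L) u n.
        move=> u0 KL; rewrite [leRHS](@big_cat_nat _ _ _ K)//= lerDl.
        by rewrite sumr_ge0.
      apply: le_trans (nneseries_lim_ge (maxn (K1 x) (K2 x)) _); last first.
        by move=> n _ _; rewrite lee_fin sqr_ge0.
      rewrite sumEFin lee_fin; under eq_bigr do rewrite cmod_sqr.
      rewrite big_split lerD// inc ?leq_maxl ?leq_maxr// => n; exact: sqr_ge0.
    have : cmod (g x) ^+ 2 <= 2 * t * F x + 24 * (S1 + S2).
      (* On some interval only the corrections remain. Otherwise [x] is outside [Om], up to the null
         set, so [F x <= t] and [F x ^+ 2 <= t * F x]. *)
      rewrite cmod_sqr /=; move: b1 b2; case: asboolP => [_|nI] b1 b2.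
        have : 0 <= 2 * t * F x by rewrite mulr_ge0.
        lra.
      have Ft : F x <= t by apply: nx2 => /nx1.
      have := cmod_sqr (f x); have := ler_wpM2l (F0 x) Ft; rewrite -/(F x); nra.
    rewrite -lee_fin => /le_trans; apply.
    by rewrite EFinD !EFinM leeD2l// lee_wpmul2l// lee_fin.
  have sumL2 : (\sum_(0 <= n <oo) L2norm2 (restr (triple (a n) (c n)) (w n)) <=
      (A * lam ^+ 2)%:E * (3 / t * nF)%:E)%E.
    apply: (@le_trans _ _ (\sum_(0 <= n <oo) ((A * lam ^+ 2)%:E * (c n - a n)%:E))%E).
      apply: lee_nneseries => [n _ _|n _].
        by apply: integral_ge0 => x _; rewrite lee_fin sqr_ge0.
      by apply: le_trans (L2w n) _; rewrite -EFinM lee_fin mulrAC.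
    rewrite nneseriesZl ?lee_wpmul2l//.
      by rewrite lee_fin mulr_ge0 ?sqr_ge0//; lra.
    by move=> n _; rewrite lee_fin.
  apply: (@le_trans _ _ ((2 * t)%:E * nF%:E + 24%:E * ((A * lam ^+ 2)%:E * (3 / t * nF)%:E))%E).
    by rewrite nFE leeD2l// lee_wpmul2l.
  rewrite nFE -!EFinM -EFinD lee_fin.
  (* Here [lam ^+ 2 / t] equals [sN * lam]. *)
  have -> : 24 * (A * lam ^+ 2 * (3 / t * nF)) = 72 * A * sN * lam * nF.
    by rewrite lamE; field; rewrite gt_eqF.
  rewrite -mulrDl ler_wpM2r//.
  have : t <= lam by rewrite lamE ler_peMr// ltW.
  have : lam <= sN * lam by rewrite ler_peMl// ltW.
  have : 0 < sN * lam by rewrite mulr_gt0.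
  rewrite /C -!mulrA; move: (sN * lam) => Y; lra.
exists a, c, g, b; do 7?split => //.
(* The series converges at every point, so the exceptional set is empty. *)
- exists set0; split; [exact: measurable0|exact: measure0|].
  by move=> x; apply; split; [exact: cv1|exact: cv2].
- apply: le_trans sumI _; rewrite nFE -EFinM lee_fin ler_wpM2r//.
  rewrite /t invf_div mulrA ler_wpM2r ?invr_ge0 ?(ltW lam0)// ler_pM2r//; lra.
-
  move=> n; have [_ _ ib fb] := wP n; split; [|split; [|split; [|split]]] => //.
  + apply: le_trans (L1I n) _; rewrite lee_fin lamE mulrA.
    apply: (@le_trans _ _ (C * (c n - a n) * t)).
      by rewrite ler_wpM2r ?(ltW t0)// ler_wpM2r.
    by rewrite ler_peMr// mulr_ge0 ?(ltW t0)// mulr_ge0//; lra.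
  + rewrite /b csubKl; apply: le_trans (L2w n) _; rewrite lee_fin.
    rewrite !exprMn sqr_sqrtr//.
    apply: (@le_trans _ _ (C ^+ 2 * (c n - a n) * lam ^+ 2)).
      rewrite ler_wpM2r ?sqr_ge0// ler_wpM2r//.
      by apply: le_trans CA _; rewrite expr2 ler_peMr//; lra.
    by rewrite ler_peMr ?exprn_ege1// mulr_ge0 ?sqr_ge0// mulr_ge0 ?sqr_ge0.
  + by move=> x nT; rewrite /b /csub !restrN ?subrr// => /IT.
Qed.
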